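(* Let $n\ge 2$, let $H$ and $K$ be $n$-Hilbert spaces over the same field, let $a_2,\dots,a_n\in H$ be linearly independent and $b_2,\dots,b_n\in K$ be linearly independent. Let $\{p_i\}_{i=1}^\infty,\{e_i\}_{i=1}^\infty$ be a pair of dual frames associated to $(a_2,\dots,a_n)$ for $H$ and let $\{q_j\}_{j=1}^\infty,\{h_j\}_{j=1}^\infty$ be a pair of dual frames associated to $(b_2,\dots,b_n)$ for $K$. Then $\{e_i\otimes h_j\}_{i,j=1}^\infty$ is a dual frame associated to $(a_2\otimes b_2,\dots,a_n\otimes b_n)$ of $\{p_i\otimes q_j\}_{i,j=1}^\infty$.
   Context: Let $\mathbb K$ be $\mathbb R$ or $\mathbb C$. An $n$-inner product on a $\mathbb K$-linear space $H$ with $\dim H\ge n$ is a map $\langle\cdot,\cdot\,|\,\cdot,\dots,\cdot\rangle:H^{n+1}\to\mathbb K$ such that for all $x,y,z,x_1,\dots,x_n\in H$ and $\alpha\in\mathbb K$: (i) $\langle x_1,x_1|x_2,\dots,x_n\rangle\ge 0$, with equality iff $x_1,\dots,x_n$ are linearly dependent; (ii) $\langle x,y|x_2,\dots,x_n\rangle=\langle x,y|x_{i_2},\dots,x_{i_n}\rangle$ for every permutation $(i_2,\dots,i_n)$ of $(2,\dots,n)$; (iii) $\langle x,y|x_2,\dots,x_n\rangle=\overline{\langle y,x|x_2,\dots,x_n\rangle}$; (iv) $\langle\alpha x,y|x_2,\dots,x_n\rangle=\alpha\langle x,y|x_2,\dots,x_n\rangle$; (v) $\langle x+y,z|x_2,\dots,x_n\rangle=\langle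 x,z|x_2,\dots,x_n\rangle+\langle y,z|x_2,\dots,x_n\rangle$. The induced $n$-norm is $\|x_1,\dots,x_n\|=\sqrt{\langle x_1,x_1|x_2,\dots,x_n\rangle}$. $H$ is an $n$-Hilbert space if every sequence $\{x_k\}$ with $\lim_{l,k\to\infty}\|x_l-x_k,e_2,\dots,e_n\|=0$ for all $e_2,\dots,e_n\in H$ has some $x\in H$ with $\lim_k\|x_k-x,e_2,\dots,e_n\|=0$ for all $e_2,\dots,e_n\in H$. Denote the $n$-inner products and $n$-norms of $H$, $K$ with subscripts $1$, $2$. A sequence $\{p_i\}$ in $H$ is a frame associated to $(a_2,\dots,a_n)$ for $H$ if there are constants $0<A\le B<\infty$ with $A\|p,a_2,\dots,a_n\|_1^2\le\sum_{i=1}^\infty|\langle p,p_i|a_2,\dots,a_n\rangle_1|^2\le B\|p,a_2,\dots,a_n\|_1^2$ for all $p\in H$; similarly for $K$. Let $L_F$ be the span of $F=\{a_2,\dots,a_n\}$ in $H$. The formula $\langle p+L_F,q+L_F\rangle_F=\langle p,q|a_2,\dots,a_n\rangle_1$ is an inner product on $H/L_F$, and $H_F$ is its Hilbert space completion; elements of $H$ are regarded in $H_F$ via their classes. $K_G$ is defined in the same way from $K$ and $G=\{b_2,\dots,b_n\}$. $H_F\otimes K_G$ is the Hilbert space tensor product, with $\langle p\otimes q,p'\otimes q'\rangle=\langle p,p'\rangle_F\langle q,q'\rangle_G$. A frame $\{e_i\}$ associated to $(a_2,\dots,a_n)$ is a dual frame of a frame $\{p_i\}$ associated to $(a_2,\dots,a_n)$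 if $p=\sum_{i=1}^\infty\langle p,e_i|a_2,\dots,a_n\rangle_1\,p_i$ for all $p\in H$, where equality and convergence are in $H_F$; $\{p_i\},\{e_i\}$ are then called a pair of dual frames. Similarly for $K$ (equality in $K_G$). Write $\langle p\otimes q,p'\otimes q'|a_2\otimes b_2,\dots,a_n\otimes b_n\rangle=\langle p,p'|a_2,\dots,a_n\rangle_1\langle q,q'|b_2,\dots,b_n\rangle_2$ and $\|p\otimes q,a_2\otimes b_2,\dots,a_n\otimes b_n\|=\|p,a_2,\dots,a_n\|_1\|q,b_2,\dots,b_n\|_2$. A family $\{u_i\otimes v_j\}_{i,j}$ with $u_i\in H$, $v_j\in K$ is a frame associated to $(a_2\otimes b_2,\dots,a_n\otimes b_n)$ for $H\otimes K$ if there are $0<A\le B<\infty$ with $A\|p\otimes q,a_2\otimes b_2,\dots\|^2\le\sum_{i,j=1}^\infty|\langle p\otimes q,u_i\otimes v_j|a_2\otimes b_2,\dots,a_n\otimes b_n\rangle|^2\le B\|p\otimes q,a_2\otimes b_2,\dots\|^2$ for all $p\in H$, $q\in K$ (where $\dots$ in the norms continues to $a_n\otimes b_n$). Given a frame $\{p_i\otimes q_j\}$ of this kind, a frame $\{e_i\otimes h_j\}$ of this kind is a dual frame of it associated to $(a_2\otimes b_2,\dots,a_n\otimes b_n)$ if $p\otimes q=\sum_{i,j=1}^\infty\langle p\otimes q,e_i\otimes h_j|a_2\otimes b_2,\dots,a_n\otimes b_n\rangle\,(p_i\otimes q_j)$ for all $p\in H$, $q\in K$, with equality and convergence in $H_F\otimes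 K_G$. *)

(* Defs.v *)
Set Warnings "-notation-overridden,-notation-incompatible-prefix,-ambiguous-paths".
From HB Require Import structures.
From mathcomp Require Import all_boot all_order all_algebra finmap perm.
From mathcomp Require Import sesquilinear complex.
From mathcomp Require Import all_classical all_reals all_analysis.
From mathcomp.analysis.showcase Require Import summability.

Set Implicit Arguments.
Unset Strict Implicit.
Unset Printing Implicit Defensive.

Import Order.TTheory GRing.Theory Num.Theory.
Import numFieldNormedType.Exports.

Local Open Scope classical_set_scope.
Local Open Scope ring_scope.

(* The scalar field is R itself or R[i]; [scalar_kind] selects which, so that
   one statement covers both cases. *)
Inductive scalar_kind := RealScalars | ComplexScalars.

Definition scalarF (R : realType) (k : scalar_kind) : numFieldType :=
  match k with
  | RealScalars => R : numFieldType
  | ComplexScalars => complex R : numFieldType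
  end.

Definition sconj {R : realType} {k : scalar_kind} :
    scalarF R k -> scalarF R k :=
  match k return scalarF R k -> scalarF R k with
  | RealScalars => fun x => x
  | ComplexScalars => fun z : complex R => conjc z
  end.

Definition sre {R : realType} {k : scalar_kind} : scalarF R k -> R :=
  match k return scalarF R k -> R with
  | RealScalars => fun x => x
  | ComplexScalars => fun z : complex R => complex.Re z
  end.

(* The norm of a numFieldType takes its values in that field; [sabs] is the
   same modulus as an element of R. *)
Definition sabs {R : realType} {k : scalar_kind} (z : scalarF R k) : R :=
  sre `|z|.

Section LinearAlgebra.
Variables (F : fieldType) (V : lmodType F).

Definition lin_indep (m : nat) (s : m.-tuple V) : Prop :=
  forall c : 'I_m -> F,
    \sum_(i < m) c i *: tnth s i = 0 -> forall i, c i = 0.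

Definition in_span (m : nat) (s : m.-tuple V) (x : V) : Prop :=
  exists c : 'I_m -> F, x = \sum_(i < m) c i *: tnth s i.

End LinearAlgebra.

Section NInnerProduct.
Variables (R : realType) (k : scalar_kind) (n : nat) (H : lmodType (scalarF R k)).

(* [ip x y t] is <x, y | t_2, ..., t_n>. *)
Implicit Types (ip : H -> H -> n.-1.-tuple H -> scalarF R k).

(* In [nip_ge0], 0 <= z in R[i] means that z is real and nonnegative. *)
Record n_inner_product ip : Prop := NInnerProduct {
  nip_dim : exists s : n.-tuple H, lin_indep s;
  nip_ge0 : forall x t, 0 <= ip x x t;
  nip_eq0 : forall x t, ip x x t = 0 <-> ~ lin_indep [tuple of x :: t];
  nip_perm : forall x y t (s : {perm 'I_n.-1}),
    ip x y t = ip x y [tuple tnth t (s i) | i < n.-1];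
  nip_conj : forall x y t, ip x y t = sconj (ip y x t);
  nip_scale : forall (c : scalarF R k) x y t, ip (c *: x) y t = c * ip x y t;
  nip_add : forall x y z t, ip (x + y) z t = ip x z t + ip y z t
}.

Definition nnorm ip (x : H) (t : n.-1.-tuple H) : R :=
  Num.sqrt (sre (ip x x t)).

Definition n_hilbert ip : Prop :=
  n_inner_product ip /\
  forall u : nat -> H,
    (forall t : n.-1.-tuple H,
       (fun lk : nat * nat => nnorm ip (u lk.1 - u lk.2) t) @ (\oo, \oo)
         --> (0 : R)) ->
    exists x : H, forall t : n.-1.-tuple H,
      (fun l : nat => nnorm ip (u l - x) t) @ \oo --> (0 : R).

Definition frame ip (a : n.-1.-tuple H) (f : nat -> H) : Prop :=
  exists A B : R, [/\ 0 < A, A <= B &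
    forall p : H,
      ((A * nnorm ip p a ^+ 2)%:E
         <= \sum_(0 <= i <oo) (sabs (ip p (f i) a) ^+ 2)%:E)%E /\
      (\sum_(0 <= i <oo) (sabs (ip p (f i) a) ^+ 2)%:E
         <= (B * nnorm ip p a ^+ 2)%:E)%E].

End NInnerProduct.

Section Hilbert.
Variables (R : realType) (k : scalar_kind).

Definition dnorm (V : lmodType (scalarF R k)) (d : {dot V for @sconj R k})
  (x : V) : R := Num.sqrt (sre (d x x)).

Record hilbert := Hilbert {
  hsort :> lmodType (scalarF R k);
  hdot : {dot hsort for @sconj R k};
  hcomplete : forall u : nat -> hsort,
    (fun lk : nat * nat => dnorm hdot (u lk.1 - u lk.2)) @ (\oo, \oo)
      --> (0 : R) ->
    exists x : hsort, (fun l : nat => dnorm hdot (u l - x)) @ \oo --> (0 : R)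
}.

Definition hnorm (X : hilbert) (x : X) : R := dnorm (hdot X) x.

(* [X] is a Hilbert space completion of V / L, where L is the span of [a] and
   V / L carries the inner product <p + L, q + L> = <p, q | a>; [j] is the
   composite V -> V / L -> X.  Completions are unique up to a unitary map
   commuting with [j]. *)
Definition quotient_completion (n : nat) (V : lmodType (scalarF R k))
    (ip : V -> V -> n.-1.-tuple V -> scalarF R k) (a : n.-1.-tuple V)
    (X : hilbert) (j : {linear V -> X}) : Prop :=
  [/\ forall x : V, j x = 0 <-> in_span a x,
      forall x y : V, hdot X (j x) (j y) = ip x y a &
      forall (z : X) (e : R), 0 < e -> exists x : V, hnorm (z - j x) < e].

(* [T] with [tau x y] as the simple tensor of x and y is the Hilbert space
   tensor product of [X] and [Y]: a completion of their algebraic tensor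
   product, again unique up to a unitary map commuting with [tau]. *)
Definition hilbert_tensor (X Y T : hilbert) (tau : {bilinear X -> Y -> T}) :
    Prop :=
  (forall x y x' y',
     hdot T (tau x y) (tau x' y') = hdot X x x' * hdot Y y y') /\
  (forall (z : T) (e : R), 0 < e ->
     exists s : seq (X * Y), hnorm (z - \sum_(xy <- s) tau xy.1 xy.2) < e).

Definition dual_frame (n : nat) (V : lmodType (scalarF R k))
    (ip : V -> V -> n.-1.-tuple V -> scalarF R k) (a : n.-1.-tuple V)
    (X : hilbert) (j : {linear V -> X}) (f g : nat -> V) : Prop :=
  [/\ frame ip a f, frame ip a g &
      forall p : V,
        (fun N : nat =>
           hnorm (\sum_(0 <= i < N) ip p (g i) a *: j (f i) - j p)) @ \oo
          --> (0 : R)].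

End Hilbert.

Section Tensor.
Variables (R : realType) (k : scalar_kind) (n : nat).
Variables (H K : lmodType (scalarF R k)).
Variables (ip1 : H -> H -> n.-1.-tuple H -> scalarF R k).
Variables (ip2 : K -> K -> n.-1.-tuple K -> scalarF R k).
Variables (a : n.-1.-tuple H) (b : n.-1.-tuple K).

(* A simple tensor p (x) q, and the data a_i (x) b_i, enter these formulas
   only through their factors. *)
Definition tensor_ip (p : H) (q : K) (p' : H) (q' : K) : scalarF R k :=
  ip1 p p' a * ip2 q q' b.

Definition tensor_nnorm (p : H) (q : K) : R := nnorm ip1 p a * nnorm ip2 q b.

Definition tensor_frame (u : nat -> H) (v : nat -> K) : Prop :=
  exists A B : R, [/\ 0 < A, A <= B &
    forall (p : H) (q : K),
      ((A * tensor_nnorm p q ^+ 2)%:E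
         <= \esum_(ij in [set: nat * nat])
              (sabs (tensor_ip p q (u ij.1) (v ij.2)) ^+ 2)%:E)%E /\
      (\esum_(ij in [set: nat * nat])
              (sabs (tensor_ip p q (u ij.1) (v ij.2)) ^+ 2)%:E
         <= (B * tensor_nnorm p q ^+ 2)%:E)%E].

(* {e_i (x) h_j} is a dual frame of {f_i (x) g_j}.  As the index set nat * nat
   carries no preferred order, the series converges unconditionally: along the
   net of its sums over finite subsets of nat * nat. *)
Definition tensor_dual_frame (X Y T : hilbert R k)
    (j1 : {linear H -> X}) (j2 : {linear K -> Y})
    (tau : {bilinear X -> Y -> T})
    (f : nat -> H) (g : nat -> K) (e : nat -> H) (h : nat -> K) : Prop :=
  [/\ tensor_frame f g, tensor_frame e h &
      forall (p : H) (q : K),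
        (fun J : {fset (nat * nat)} =>
           hnorm (partial_sum
                    (fun ij : nat * nat =>
                       tensor_ip p q (e ij.1) (h ij.2)
                         *: tau (j1 (f ij.1)) (j2 (g ij.2))) J
                  - tau (j1 p) (j2 q))) @ totally
          --> (0 : R)].

End Tensor.

(* Main.v *)
Require Import Defs.
Set Warnings "-notation-overridden,-notation-incompatible-prefix,-ambiguous-paths".
From mathcomp Require Import all_boot all_order all_algebra.
From mathcomp Require Import sesquilinear.
From mathcomp Require Import all_classical all_reals all_analysis.
From mathcomp Require Import finmap complex ring lra.
From mathcomp.analysis.showcase Require Import summability.

Set Implicit Arguments.
Unset Strict Implicit.
Unset Printing Implicit Defensive.

Import Order.TTheory GRing.Theory Num.Theory.
Import numFieldNormedType.Exports.

(** Write x_i, y_j for the images of p_i, q_j in the two completions X and Y,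
    c_i = <u, e_i | a> and c'_j = <v, h_j | b> for the coefficients of u and v,
    and ||.|| for the norms of X, Y and their tensor product.

    The frame inequalities for the simple tensors are products of those of the
    factors, since the double series of |c_i c'_j|^2 is the product of the two
    single series ([frame_tensor]).

    For the expansion, the square partial sums factor as
    (sum_(i < N) c_i x_i) (x) (sum_(j < N) c'_j y_j), and this tends to
    u (x) v because both factors converge and ||x (x) y|| = ||x|| ||y||.  What
    makes the convergence unconditional is a bound on sums over arbitrary
    finite sets of indices,
      || sum_ij d_ij x_i (x) y_j ||^2 <= B B' sum_ij |d_ij|^2
    ([tensor_synthesis]), where B and B' are the upper frame bounds: if a finite
    set J contains the square [0, N)^2, then the sum over the rest of J has
    squared norm at most B B' times a tail of the convergent double series of
    |c_i c'_j|^2 ([sqn_square_tail_le]).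

    In a single factor the corresponding bound is dual to the Bessel inequality
    ([synthesis_bound]).  It passes to tensors in the vector-valued form
      || sum_i x_i (x) w_i ||^2 <= B sum_i ||w_i||^2
    ([sqn_sum_tau_le]).  If the w_i are orthogonalised one direction w at a
    time, w_i = c_i w + v_i with v_i orthogonal to w, then both sides split: the
    part along w is (sum_i c_i x_i) (x) w, to which the scalar bound applies,
    and the part with the v_i has one nonzero vector less. *)

Local Open Scope ring_scope.
Local Open Scope complex_scope.

(** * Real parts, conjugates and moduli of scalars *)

Section ComplexScalars.
Variable R : realType.
Implicit Types z w : R[i].

Lemma Re_normM z w : complex.Re `|z * w| = complex.Re `|z| * complex.Re `|w|.
Proof.
rewrite normrM -(RRe_real (ger0_real (normr_ge0 z))).
by rewrite -(RRe_real (ger0_real (normr_ge0 w))) -rmorphM.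
Qed.

Lemma Re_normJ z : complex.Re `|conjc z| = complex.Re `|z|.
Proof. by rewrite normcJ. Qed.

Lemma Re_mul_real z w : 0 <= z -> 0 <= w ->
  complex.Re (w * z) = complex.Re w * complex.Re z.
Proof. by move=> /ger0_real/RRe_real <- /ger0_real/RRe_real <-; rewrite -rmorphM. Qed.

Lemma Re_mulJ z w : 0 <= w ->
  complex.Re (z * conjc z * w) = complex.Re `|z| ^+ 2 * complex.Re w.
Proof.
move=> /ger0_real/RRe_real <-; rewrite -sqr_normc.
by rewrite -(RRe_real (ger0_real (normr_ge0 z))) -rmorphXn -rmorphM.
Qed.

End ComplexScalars.

Section Scalars.
Variables (R : realType) (k : scalar_kind).
Implicit Types z w : scalarF R k.

Lemma sconj0 : sconj (0 : scalarF R k) = 0.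
Proof. by case: k => //; exact: (rmorph0 (@conjc R)). Qed.

Lemma sconjM z w : sconj (z * w) = sconj z * sconj w.
Proof. by case: k z w => // z w; exact: (rmorphM (@conjc R)). Qed.

Lemma sre0 : sre (0 : scalarF R k) = 0.
Proof. by case: k. Qed.

Lemma sreD z w : sre (z + w) = sre z + sre w.
Proof. by case: k z w => // [[a b] [c d]]. Qed.

Lemma sre_conj z : sre (sconj z) = sre z.
Proof. by case: k z => // [[a b]]. Qed.

Lemma sre_sum I (r : seq I) (P : pred I) (F : I -> scalarF R k) :
  sre (\sum_(i <- r | P i) F i) = \sum_(i <- r | P i) sre (F i).
Proof. exact: (big_morph _ sreD sre0). Qed.

Lemma sre_gt0 z : 0 < z -> 0 < sre z.
Proof. by case: k z => //= z; rewrite ltcE => /andP[]. Qed.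

Lemma sabsM z w : sabs (z * w) = sabs z * sabs w.
Proof.
rewrite /sabs; case: k z w => /= z w; first exact: normrM.
exact: Re_normM.
Qed.

Lemma sabs_conj z : sabs (sconj z) = sabs z.
Proof. by rewrite /sabs; case: k z => //= z; exact: Re_normJ. Qed.

Lemma sabs0 : sabs (0 : scalarF R k) = 0.
Proof. by rewrite /sabs normr0 sre0. Qed.

Lemma sre_le_sabs z : sre z <= sabs z.
Proof.
rewrite /sabs; case: k z => /= z; first exact: ler_norm.
have := normc_ge_Re z; rewrite lecE => /andP[_]; apply: le_trans.
exact: ler_norm.
Qed.

Lemma sre_mul_conj z w : 0 <= w -> sre (z * sconj z * w) = sabs z ^+ 2 * sre w.
Proof.
rewrite /sabs; case: k z w => /= z w w0.
  by rewrite -expr2 real_normK// num_real.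
exact: Re_mulJ.
Qed.

End Scalars.

(** * Squared norms and the synthesis bound *)

(** The squared norm of [x] for the inner product [d], as a real number. *)
Local Notation sqn d x := (sre (d x x)).

Section Dot.
Variables (R : realType) (k : scalar_kind) (V : lmodType (scalarF R k)).
Variable d : {dot V for @sconj R k}.
Implicit Types x y : V.

Lemma dotC x y : d x y = sconj (d y x).
Proof. by rewrite (@hermitian_subproof _ _ _ _ d) expr0 mul1r. Qed.

(* The additivity and homogeneity lemmas of bilinear maps are restated for [d],
   and below for [tau], so that they rewrite at a fixed structure. *)
Lemma dotDl x y z : d (x + y) z = d x z + d y z.
Proof. exact: linearDl. Qed.

Lemma dotDr x y z : d x (y + z) = d x y + d x z.
Proof. exact: linearDr. Qed.

Lemma dotNr x y : d x (- y) = - d x y.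
Proof. exact: linearNr. Qed.

Lemma dotNl x y : d (- x) y = - d x y.
Proof. exact: linearNl. Qed.

Lemma dot_sumr I (r : seq I) (P : pred I) (y : I -> V) x :
  d x (\sum_(i <- r | P i) y i) = \sum_(i <- r | P i) d x (y i).
Proof. exact: linear_sumr. Qed.

Lemma dotZl c x y : d (c *: x) y = c * d x y.
Proof. exact: linearZl_LR. Qed.

Lemma dotZr c x y : d x (c *: y) = sconj c * d x y.
Proof. by rewrite dotC dotZl sconjM -dotC. Qed.

Lemma dot_ge0 x : 0 <= d x x.
Proof.
have [->|x0] := eqVneq x 0; first by rewrite linear0r.
by apply/ltW/neq0_dnorm_gt0.
Qed.

Lemma sqn_gt0 x : x != 0 -> 0 < sqn d x.
Proof. by move=> x0; apply/sre_gt0/neq0_dnorm_gt0. Qed.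

Lemma sqn_ge0 x : 0 <= sqn d x.
Proof.
have [->|x0] := eqVneq x 0; first by rewrite linear0r sre0.
exact/ltW/sqn_gt0.
Qed.

Lemma dnorm_sqr x : dnorm d x ^+ 2 = sqn d x.
Proof. by rewrite sqr_sqrtr// sqn_ge0. Qed.

Lemma sqnZ c x : sqn d (c *: x) = sabs c ^+ 2 * sqn d x.
Proof.
by rewrite dotZl dotZr mulrA sre_mul_conj// dot_ge0.
Qed.

Lemma sqnD x y : sqn d (x + y) = sqn d x + sre (d x y) *+ 2 + sqn d y.
Proof.
rewrite dotDl !dotDr !sreD (dotC y x) sre_conj mulr2n; ring.
Qed.

Lemma sqnN x : sqn d (- x) = sqn d x.
Proof. by rewrite dotNl dotNr opprK. Qed.

Lemma sqnD_le x y : sqn d (x + y) <= 2 * sqn d x + 2 * sqn d y.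
Proof.
have := sqn_ge0 (x - y); rewrite !sqnD sqnN dotNr.
have -> : sre (- d x y) = - sre (d x y).
  by apply/eqP; rewrite -addr_eq0 -sreD addNr sre0.
rewrite mulNrn; lra.
Qed.

Lemma sqnD_orth x y : d x y = 0 -> sqn d (x + y) = sqn d x + sqn d y.
Proof. by move=> xy0; rewrite sqnD xy0 sre0 mul0rn addr0. Qed.

(** The synthesis map c |-> sum_i c_i x_i is bounded on finitely supported
    coefficients, with squared norm at most [B]. *)
Definition synthesis_bounded (B : R) (x : nat -> V) : Prop :=
  forall (m : nat) (c : nat -> scalarF R k),
    sqn d (\sum_(i < m) c i *: x i) <= B * \sum_(i < m) sabs (c i) ^+ 2.

(** The Bessel inequality is needed only at the synthesised vector itself, so
    that a frame inequality valid on a mere subspace containing the [x i] is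
    enough. *)
Lemma synthesis_bound (B : R) (x : nat -> V) (m : nat)
    (c : nat -> scalarF R k) (y : V) :
  0 < B -> y = \sum_(i < m) c i *: x i ->
  \sum_(i < m) sabs (d y (x i)) ^+ 2 <= B * sqn d y ->
  sqn d y <= B * \sum_(i < m) sabs (c i) ^+ 2.
Proof.
move=> B0 yS By.
have yE : sqn d y = \sum_(i < m) sre (sconj (c i) * d y (x i)).
  rewrite {2}yS dot_sumr sre_sum; apply: eq_bigr => i _.
  by rewrite dotZr.
(* 2 B |c_i| |<y, x_i>| <= B^2 |c_i|^2 + |<y, x_i>|^2, summed over i; the last
   term is absorbed by the Bessel inequality. *)
have : B * (sqn d y *+ 2) <= B ^+ 2 * \sum_(i < m) sabs (c i) ^+ 2
    + \sum_(i < m) sabs (d y (x i)) ^+ 2.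
  rewrite {1}yE -sumrMnl !mulr_sumr -big_split /=; apply: ler_sum => i _.
  have := sre_le_sabs (sconj (c i) * d y (x i)); rewrite sabsM sabs_conj => h.
  apply: (@le_trans _ _ (B * (sabs (c i) * sabs (d y (x i)) *+ 2))).
    by apply: ler_wpM2l; [exact: ltW|rewrite lerMn2r h].
  rewrite -subr_ge0 -exprMn mulrnAr mulrA.
  rewrite addrAC -sqrrB; exact: sqr_ge0.
move=> h; rewrite -(ler_pM2l B0); move: h; rewrite mulrA -expr2; lra.
Qed.

End Dot.

(** * The synthesis bound for tensors *)

Section TensorSqn.
Variables (R : realType) (k : scalar_kind) (X Y T : lmodType (scalarF R k)).
Variables (dX : {dot X for @sconj R k}) (dY : {dot Y for @sconj R k})
  (dT : {dot T for @sconj R k}) (tau : {bilinear X -> Y -> T}).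
Hypothesis dotT : forall x y x' y',
  dT (tau x y) (tau x' y') = dX x x' * dY y y'.

Lemma sqn_tau x y : sqn dT (tau x y) = sqn dX x * sqn dY y.
Proof.
rewrite dotT; have := dot_ge0 dX x; have := dot_ge0 dY y.
move: (dX x x) (dY y y) => u v; rewrite /sre; case: k u v => //= u v u0 v0.
exact: Re_mul_real.
Qed.

Lemma tauZl c x y : tau (c *: x) y = c *: tau x y.
Proof. exact: linearZl_LR. Qed.

Lemma tauZr c x y : tau x (c *: y) = c *: tau x y.
Proof. exact: linearZr_LR. Qed.

Lemma tauDr x y y' : tau x (y + y') = tau x y + tau x y'.
Proof. exact: linearDr. Qed.

Lemma tauBl x x' y : tau (x - x') y = tau x y - tau x' y.
Proof. exact: linearBl. Qed.

Lemma tauBr x y y' : tau x (y - y') = tau x y - tau x y'.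
Proof. exact: linearBr. Qed.

Lemma tau_suml I (r : seq I) (P : pred I) (x : I -> X) y :
  tau (\sum_(i <- r | P i) x i) y = \sum_(i <- r | P i) tau (x i) y.
Proof. exact: linear_sumlz. Qed.

Lemma tau_sumr I (r : seq I) (P : pred I) (y : I -> Y) x :
  tau x (\sum_(i <- r | P i) y i) = \sum_(i <- r | P i) tau x (y i).
Proof. exact: linear_sumr. Qed.

(** The synthesis bound with vector coefficients [w i] in place of scalars. *)
Lemma sqn_sum_tau_le (B : R) (x : nat -> X) (m : nat) (w : nat -> Y) :
  synthesis_bounded dX B x ->
  sqn dT (\sum_(i < m) tau (x i) (w i)) <= B * \sum_(i < m) sqn dY (w i).
Proof.
move=> synth.
(* Induction on the length l of the initial segment that carries the nonzero
   w_i; each step splits off the direction of the last of them. *)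
suff: forall l w, (forall i, (l <= i)%N -> w i = 0) ->
    sqn dT (\sum_(i < m) tau (x i) (w i)) <= B * \sum_(i < m) sqn dY (w i).
  move=> /(_ m (fun i => if (i < m)%N then w i else 0)) ind.
  have E (Z : nmodType) (F : nat -> Y -> Z) :
      \sum_(i < m) F i (if (i < m)%N then w i else 0) = \sum_(i < m) F i (w i).
    by apply: eq_bigr => i _; rewrite ltn_ord.
  move: ind; rewrite (E _ (fun i u => tau (x i) u)) (E _ (fun i u => sqn dY u)).
  by apply=> i; rewrite leqNgt => /negbTE ->.
elim => [|l IHl] {}w w0.
  have -> : \sum_(i < m) tau (x i) (w i) = 0.
    by rewrite big1// => i _; rewrite w0//; exact: linear0r.
  rewrite big1 ?mulr0; first by rewrite linear0l sre0.
  by move=> i _; rewrite w0// linear0l sre0.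
have [wl0|wl0] := eqVneq (w l) 0.
  apply: IHl => i; rewrite leq_eqVlt => /orP[/eqP <- //|]; exact: w0.
have rho0 : dY (w l) (w l) != 0 by rewrite gt_eqF// neq0_dnorm_gt0.
pose c i : scalarF R k := dY (w i) (w l) / dY (w l) (w l).
pose v i := w i - c i *: w l.
have vE i : w i = c i *: w l + v i by rewrite addrC subrK.
have v0 i : (l <= i)%N -> v i = 0.
  rewrite leq_eqVlt => /orP[/eqP <-|/w0 wi0].
    by rewrite /v /c divff// scale1r subrr.
  by rewrite /v /c wi0 linear0l mul0r scale0r subrr.
have orth i : dY (w l) (v i) = 0.
  by rewrite dotC dotDl dotNl dotZl /c divfK// subrr sconj0.
have -> : \sum_(i < m) tau (x i) (w i) =
    tau (\sum_(i < m) c i *: x i) (w l) + \sum_(i < m) tau (x i) (v i).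
  rewrite tau_suml -big_split; apply: eq_bigr => i _ /=.
  by rewrite {1}vE tauDr tauZr tauZl.
have -> : \sum_(i < m) sqn dY (w i) =
    (\sum_(i < m) sabs (c i) ^+ 2) * sqn dY (w l) + \sum_(i < m) sqn dY (v i).
  rewrite mulr_suml -big_split; apply: eq_bigr => i _ /=.
  by rewrite {1 2}vE sqnD_orth ?sqnZ// dotZl orth mulr0.
rewrite sqnD_orth; last first.
  by rewrite dot_sumr big1// => i _; rewrite dotT orth mulr0.
by rewrite mulrDr lerD ?IHl// sqn_tau mulrA ler_wpM2r ?sqn_ge0.
Qed.

Lemma tensor_synthesis (B B' : R) (x : nat -> X) (y : nat -> Y) (m : nat)
    (c : nat -> nat -> scalarF R k) : 0 <= B ->
  synthesis_bounded dX B x ->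
  synthesis_bounded dY B' y ->
  sqn dT (\sum_(i < m) \sum_(j < m) c i j *: tau (x i) (y j))
    <= B * B' * \sum_(i < m) \sum_(j < m) sabs (c i j) ^+ 2.
Proof.
move=> B0 synthX synthY.
pose w i := \sum_(j < m) c i j *: y j.
rewrite (eq_bigr (fun i : 'I_m => tau (x i) (w i))); last first.
  by move=> i _; rewrite tau_sumr; apply: eq_bigr => j _; rewrite tauZr.
apply: le_trans (sqn_sum_tau_le m w synthX) _.
rewrite -mulrA ler_wpM2l// mulr_sumr; apply: ler_sum => i _.
exact: synthY.
Qed.

End TensorSqn.

(** * Unconditional convergence of the tensor expansion *)

(** A sum over a finite set of pairs is a sum over any square containing it, of
    the terms extended by 0. *)
Lemma partial_sum_square (V : zmodType) (f : nat * nat -> V)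
    (J : {fset nat * nat}) (M : nat) :
  (forall ij, ij \in J -> (ij.1 < M)%N && (ij.2 < M)%N) ->
  partial_sum f J =
    \sum_(i < M) \sum_(j < M)
      if (i : nat, j : nat) \in J then f (i : nat, j : nat) else 0.
Proof.
move=> JM; pose r := [seq (i, j) | i <- iota 0 M, j <- iota 0 M].
have rE ij : (ij \in r) = (ij.1 < M)%N && (ij.2 < M)%N.
  case: ij => i j; apply/allpairsP/andP => [[[i' j'] /=]|[/= iM jM]].
    by rewrite !mem_iota !add0n => -[/andP[_ ?] /andP[_ ?] [-> ->]].
  by exists (i, j); rewrite !mem_iota !add0n.
have ur : uniq r by apply: allpairs_uniq; rewrite ?iota_uniq// => -[? ?] [].
have perm : perm_eq J [seq ij <- r | ij \in J].
  apply: uniq_perm; rewrite ?filter_uniq ?fset_uniq// => ij.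
  by rewrite mem_filter rE; case: (boolP (ij \in J)) => // /JM ->.
rewrite /partial_sum -(big_seq_fsetE _ _ predT f) /= (perm_big _ perm) big_filter.
rewrite big_mkcond /r big_allpairs_dep /=.
pose g i j := if (i, j) \in J then f (i, j) else 0.
rewrite -(big_mkord xpredT (fun i => \sum_(j < M) g i j)).
rewrite /index_iota subn0; apply: eq_bigr => i _.
by rewrite -(big_mkord xpredT (g i)) /index_iota subn0.
Qed.

Lemma square_widen (V : nmodType) (f : nat -> nat -> V) (N M : nat) : (N <= M)%N ->
  \sum_(i < N) \sum_(j < N) f i j =
    \sum_(i < M) \sum_(j < M) if (i < N)%N && (j < N)%N then f i j else 0.
Proof.
move=> NM; rewrite (big_ord_widen M (fun i => \sum_(j < N) f i j))// big_mkcond /=.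
apply: eq_bigr => i _; case: ifP => iN /=; last by rewrite big1.
by rewrite (big_ord_widen M (f i))// big_mkcond.
Qed.

Lemma cvgcM (R : realType) (a l : R) (f : nat -> R) :
  (f @ \oo --> l -> (fun m => a * f m) @ \oo --> a * l)%classic.
Proof. by move=> fl; apply: cvgM => //; exact: cvg_cst. Qed.

Section TensorExpansion.
Local Open Scope classical_set_scope.
Variables (R : realType) (k : scalar_kind) (X Y T : lmodType (scalarF R k)).
Variables (dX : {dot X for @sconj R k}) (dY : {dot Y for @sconj R k})
  (dT : {dot T for @sconj R k}) (tau : {bilinear X -> Y -> T}).
Hypothesis dotT : forall x y x' y',
  dT (tau x y) (tau x' y') = dX x x' * dY y y'.
Variables (B B' : R) (x : nat -> X) (y : nat -> Y) (c c' : nat -> scalarF R k).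
Hypothesis B0 : 0 < B.
Hypothesis B'0 : 0 < B'.
Hypothesis synthX : synthesis_bounded dX B x.
Hypothesis synthY : synthesis_bounded dY B' y.

Let s m := \sum_(i < m) c i *: x i.
Let s' m := \sum_(i < m) c' i *: y i.
Let C m := \sum_(i < m) sabs (c i) ^+ 2.
Let C' m := \sum_(i < m) sabs (c' i) ^+ 2.
Let S J := partial_sum (fun ij : nat * nat =>
  (c ij.1 * c' ij.2) *: tau (x ij.1) (y ij.2)) J.

Lemma tau_partial_sums m : tau (s m) (s' m) =
  \sum_(i < m) \sum_(j < m) (c i * c' j) *: tau (x i) (y j).
Proof.
rewrite tau_suml; apply: eq_bigr => i _; rewrite tau_sumr.
by apply: eq_bigr => j _; rewrite tauZl tauZr scalerA.
Qed.

Lemma coef_square m :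
  \sum_(i < m) \sum_(j < m) sabs (c i * c' j) ^+ 2 = C m * C' m.
Proof.
rewrite /C /C' mulr_suml; apply: eq_bigr => i _; rewrite mulr_sumr.
by apply: eq_bigr => j _; rewrite sabsM exprMn.
Qed.

(** The part of a finite sum outside a square of indices is small: [M] only
    bounds the indices in [J], and [C M * C' M - C N * C' N] is a piece of the
    double series of |c_i c'_j|^2. *)
Lemma sqn_square_tail_le (N M : nat) (J : {fset nat * nat}) : (N <= M)%N ->
  (forall ij, ij \in J -> (ij.1 < M)%N && (ij.2 < M)%N) ->
  (forall ij, (ij.1 < N)%N && (ij.2 < N)%N -> ij \in J) ->
  sqn dT (S J - tau (s N) (s' N)) <= B * B' * (C M * C' M - C N * C' N).
Proof.
move=> NM JM NJ; pose out i j := ((i, j) \in J) && ~~ ((i < N)%N && (j < N)%N).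
pose d i j : scalarF R k := if out i j then c i * c' j else 0.
have -> : S J - tau (s N) (s' N) =
    \sum_(i < M) \sum_(j < M) d i j *: tau (x i) (y j).
  rewrite /S (partial_sum_square _ JM) tau_partial_sums.
  rewrite (square_widen (fun i j => (c i * c' j) *: tau (x i) (y j)) NM).
  rewrite -sumrB; apply: eq_bigr => i _; rewrite -sumrB; apply: eq_bigr => j _.
  rewrite /d /out /=; case: (boolP ((i < N)%N && (j < N)%N)) => [ijN|_].
    by rewrite NJ//= subrr scale0r.
  by rewrite subr0 andbT; case: ifP => // _; rewrite scale0r.
apply: le_trans (tensor_synthesis dotT M d (ltW B0) synthX synthY) _.
rewrite ler_wpM2l ?(mulr_ge0 (ltW B0) (ltW B'0))// -!coef_square.
rewrite (square_widen (fun i j => sabs (c i * c' j) ^+ 2) NM) -sumrB.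
apply: ler_sum => i _; rewrite -sumrB; apply: ler_sum => j _.
rewrite /d /out; case: ((i < N)%N && (j < N)%N).
  by rewrite andbF sabs0 expr0n/= subrr.
by rewrite andbT subr0; case: ifP => // _; rewrite sabs0 expr0n/= sqr_ge0.
Qed.

(** Square-summable coefficients and convergence of both factor expansions give
    unconditional convergence of the tensor expansion. *)
Lemma tensor_expansion (D D' : R) (u : X) (v : Y) :
  (forall m, C m <= D) -> (forall m, C' m <= D') ->
  (fun m => sqn dX (s m - u)) @ \oo --> (0 : R) ->
  (fun m => sqn dY (s' m - v)) @ \oo --> (0 : R) ->
  (fun J : {fset nat * nat} => dnorm dT (S J - tau u v)) @ totally --> (0 : R).
Proof.
move=> CD CD' su sv.
have C0 m : 0 <= C m by apply: sumr_ge0 => i _; exact: sqr_ge0.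
have C'0 m : 0 <= C' m by apply: sumr_ge0 => i _; exact: sqr_ge0.
have CC_nd : nondecreasing_seq (fun m => C m * C' m).
  by apply/nondecreasing_seqP => m; rewrite ler_pM// /C /C' big_ord_recr lerDl sqr_ge0.
have CC_cvg : cvgn (fun m => C m * C' m).
  apply: nondecreasing_is_cvgn => //; exists (D * D') => _ [m _ <-].
  by rewrite ler_pM.
pose L := limn (fun m => C m * C' m).
(* E N bounds ||S J - u (x) v||^2 for every finite J containing [0, N)^2.  Each
   factor 2 comes from ||x + y||^2 <= 2 ||x||^2 + 2 ||y||^2; the factor
   2 ||s' m - v||^2 + 2 ||v||^2 bounds ||s' m||^2. *)
pose E m := 2 * (B * B' * (L - C m * C' m)) +
  2 * (2 * (sqn dX (s m - u) * (2 * sqn dY (s' m - v) + 2 * sqn dY v))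
       + 2 * (sqn dX u * sqn dY (s' m - v))).
have E0 : E @ \oo --> (0 : R).
  have -> : (0 : R) = 2 * (B * B' * (L - L)) +
      2 * (2 * (0 * (2 * 0 + 2 * sqn dY v)) + 2 * (sqn dX u * 0)).
    by rewrite subrr !(mulr0, mul0r, addr0).
  apply: cvgD; apply: cvgcM.
    by apply: cvgcM; apply: cvgB; [exact: cvg_cst|exact: CC_cvg].
  apply: cvgD; apply: cvgcM; last exact: cvgcM.
  by apply: cvgM => //; apply: cvgD; [exact: cvgcM|exact: cvg_cst].
have totF : Filter (@totally (nat * nat)%type) by apply: totally_filter.
apply/cvgrPdist_lt => e e0.
have [N _ /(_ N (leqnn N))] : \forall m \near \oo, E m < e ^+ 2.
  move/cvgrPdist_lt: E0 => /(_ (e ^+ 2) (exprn_gt0 _ e0)).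
  by apply: filterS => m; rewrite sub0r normrN; exact/le_lt_trans/ler_norm.
move=> /= ENe.
have [J0 J0E] : exists J0 : {fset nat * nat},
    forall ij, (ij.1 < N)%N && (ij.2 < N)%N -> ij \in J0.
  exists (seq_fset tt [seq (i, j) | i <- iota 0 N, j <- iota 0 N]) => -[i j].
  move=> /andP[iN jN]; rewrite seq_fsetE; apply/allpairsP.
  by exists (i, j); rewrite !mem_iota.
exists J0 => //= J J0J.
rewrite sub0r normrN ger0_norm ?sqrtr_ge0//.
rewrite -(ltr_pXn2r (_ : 0 < 2)%N) ?nnegrE ?sqrtr_ge0 ?ltW//.
rewrite dnorm_sqr; apply: le_lt_trans ENe.
pose M := (N + \max_(ij <- J) (maxn ij.1 ij.2).+1)%N.
have JM ij : ij \in J -> (ij.1 < M)%N && (ij.2 < M)%N.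
  move=> ijJ; rewrite -gtn_max; apply: leq_trans (leq_addl _ _).
  exact: (@leq_bigmax_seq _ _ predT
    (fun ij : nat * nat => (maxn ij.1 ij.2).+1)).
have NJ ij : (ij.1 < N)%N && (ij.2 < N)%N -> ij \in J.
  by move=> ijN; apply: (fsubsetP J0J); exact: J0E.
have := sqn_square_tail_le (leq_addr _ N : (N <= M)%N) JM NJ.
have CML : C M * C' M <= L by exact: nondecreasing_cvgn_le.
have -> : S J - tau u v = (S J - tau (s N) (s' N)) +
    (tau (s N - u) (s' N) + tau u (s' N - v)).
  by rewrite tauBl tauBr !subrKA.
move=> tail; apply: le_trans (sqnD_le _ _ _) _; apply: lerD.
  rewrite ler_pM2l//; apply: le_trans tail _.
  by rewrite ler_wpM2l ?(mulr_ge0 (ltW B0) (ltW B'0))// lerD2r.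
rewrite ler_pM2l//; apply: le_trans (sqnD_le _ _ _) _.
rewrite !(sqn_tau dotT) lerD// ler_pM2l// ler_wpM2l ?sqn_ge0//.
by rewrite -[in leLHS](subrK v (s' N)) sqnD_le.
Qed.

End TensorExpansion.

(** * Frames and their tensor products *)

Lemma sqn_cvg0 (R : realType) (k : scalar_kind) (X : hilbert R k)
    (F : nat -> X) (x : X) :
  ((fun N => hnorm (\sum_(0 <= i < N) F i - x)) @ \oo --> (0 : R))%classic ->
  ((fun N => sqn (hdot X) (\sum_(i < N) F i - x)) @ \oo --> (0 : R))%classic.
Proof.
move=> hF; have -> : (fun N => sqn (hdot X) (\sum_(i < N) F i - x)) =
    (fun N => hnorm (\sum_(0 <= i < N) F i - x) ^+ 2).
  by apply/funext => N; rewrite /hnorm dnorm_sqr big_mkord.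
by rewrite -[X in (_ --> X)%classic](mulr0 0); exact: (cvgM hF hF).
Qed.

Section FramePartialSums.
Variables (R : realType) (k : scalar_kind) (n : nat).
Variables (V X : lmodType (scalarF R k)) (d : {dot X for @sconj R k}).
Variables (ip : V -> V -> n.-1.-tuple V -> scalarF R k) (a : n.-1.-tuple V).
Variable j : {linear V -> X}.
Hypothesis dotj : forall x y : V, d (j x) (j y) = ip x y a.

(** The Bessel inequality for finite sums, on the image of [j]; it also bounds
    the squared coefficients of a fixed vector in a dual expansion. *)
Lemma frame_bessel (f : nat -> V) : frame ip a f ->
  exists2 B : R, 0 < B & forall p m,
    \sum_(i < m) sabs (ip p (f i) a) ^+ 2 <= B * sqn d (j p).
Proof.
move=> [A [B [A0 AB fr]]]; exists B; first exact: lt_le_trans AB.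
move=> p m; have [_ up] := fr p; rewrite -lee_fin -sumEFin.
apply: (@le_trans _ _ (B * nnorm ip p a ^+ 2)%:E); last first.
  by rewrite lee_fin /nnorm -dotj sqr_sqrtr ?sqn_ge0.
apply: le_trans up.
rewrite -(big_mkord xpredT (fun i => (sabs (ip p (f i) a) ^+ 2)%:E)).
by apply: nneseries_lim_ge => i _ _; rewrite lee_fin sqr_ge0.
Qed.

Lemma frame_synthesis (f : nat -> V) : frame ip a f ->
  exists2 B : R, 0 < B & synthesis_bounded d B (fun i => j (f i)).
Proof.
move=> /frame_bessel[B B0 bessel]; exists B => // m c.
apply: (synthesis_bound (x := fun i => j (f i)) B0 erefl).
(* The Bessel inequality is known on the image of j, where the sum lies. *)
have -> : \sum_(i < m) c i *: j (f i) = j (\sum_(i < m) c i *: f i).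
  by rewrite linear_sum; apply: eq_bigr => i _; rewrite linearZ.
apply: le_trans (bessel _ m); apply: ler_sum => i _.
by rewrite dotj.
Qed.

End FramePartialSums.

Lemma esum_prod (R : realType) (f g : nat -> R) :
  (forall i, 0 <= f i) -> (forall i, 0 <= g i) ->
  (\sum_(0 <= i <oo) (g i)%:E \is a fin_num)%E ->
  (\esum_(ij in [set: nat * nat]%classic) (f ij.1 * g ij.2)%:E =
   (\sum_(0 <= i <oo) (f i)%:E) * (\sum_(0 <= i <oo) (g i)%:E))%E.
Proof.
move=> f0 g0 gfin.
have -> : [set: nat * nat]%classic = ([set: nat] `*`` (fun=> [set: nat]))%classic.
  by apply/seteqP; split.
rewrite -(esum_esum (a := fun i j => (f i * g j)%:E)); last first.
  by move=> i j _ _; rewrite lee_fin mulr_ge0.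
rewrite -nneseries_esumT; last first.
  by move=> i; apply: esum_ge0 => j _; rewrite lee_fin mulr_ge0.
rewrite muleC -(fineK gfin) -nneseriesZl; last by move=> i _; rewrite lee_fin.
apply: eq_eseriesr => i _; rewrite fineK// -nneseries_esumT; last first.
  by move=> j; rewrite lee_fin mulr_ge0.
rewrite muleC -nneseriesZl; last by move=> j _; rewrite lee_fin.
by apply: eq_eseriesr => j _; rewrite EFinM.
Qed.

Lemma frame_tensor (R : realType) (k : scalar_kind) (n : nat)
    (H K : lmodType (scalarF R k))
    (ip1 : H -> H -> n.-1.-tuple H -> scalarF R k)
    (ip2 : K -> K -> n.-1.-tuple K -> scalarF R k)
    (a : n.-1.-tuple H) (b : n.-1.-tuple K) (u : nat -> H) (v : nat -> K) :
  frame ip1 a u -> frame ip2 b v -> tensor_frame ip1 ip2 a b u v.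
Proof.
move=> [A [B [A0 AB fr]]] [A' [B' [A'0 AB' fr']]].
exists (A * A'), (B * B'); split; first exact: mulr_gt0.
  by apply: ler_pM => //; exact: ltW.
move=> p q; have [lo up] := fr p; have [lo' up'] := fr' q.
set S := (\sum_(0 <= i <oo) _)%E in lo up.
set S' := (\sum_(0 <= i <oo) _)%E in lo' up'.
have S0 : (0 <= S)%E by apply: nneseries_ge0 => i _ _; rewrite lee_fin sqr_ge0.
have S'0 : (0 <= S')%E by apply: nneseries_ge0 => i _ _; rewrite lee_fin sqr_ge0.
have S'fin : S' \is a fin_num by rewrite ge0_fin_numE// (le_lt_trans up')// ltry.
have -> : (\esum_(ij in [set: nat * nat]%classic)
    (sabs (tensor_ip ip1 ip2 a b p q (u ij.1) (v ij.2)) ^+ 2)%:E = S * S')%E.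
  rewrite -esum_prod//; [|by move=> i; exact: sqr_ge0..].
  by apply: eq_esum => ij _; rewrite /tensor_ip sabsM exprMn.
rewrite /tensor_nnorm exprMn (mulrACA A) (mulrACA B) !EFinM.
split; apply: lee_pmul => //.
- by rewrite lee_fin mulr_ge0 ?sqr_ge0// ltW.
- by rewrite lee_fin mulr_ge0 ?sqr_ge0// ltW.
Qed.

Theorem theorem4p6 (R : realType) (k : scalar_kind) (n : nat) (hn : (2 <= n)%N)
    (H K : lmodType (scalarF R k))
    (ip1 : H -> H -> n.-1.-tuple H -> scalarF R k)
    (ip2 : K -> K -> n.-1.-tuple K -> scalarF R k)
    (hH : n_hilbert ip1) (hK : n_hilbert ip2)
    (a : n.-1.-tuple H) (b : n.-1.-tuple K)
    (ha : lin_indep a) (hb : lin_indep b)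
    (HF : hilbert R k) (jF : {linear H -> HF})
    (hHF : quotient_completion ip1 a jF)
    (KG : hilbert R k) (jG : {linear K -> KG})
    (hKG : quotient_completion ip2 b jG)
    (HK : hilbert R k) (tau : {bilinear HF -> KG -> HK})
    (hHK : hilbert_tensor tau)
    (p e : nat -> H) (q h : nat -> K)
    (hpe : dual_frame ip1 a jF p e)
    (hqh : dual_frame ip2 b jG q h) :
  tensor_dual_frame ip1 ip2 a b jF jG tau p q e h.
Proof.
have [_ dotF _] := hHF; have [_ dotG _] := hKG; have [dotT _] := hHK.
have [frp fre expF] := hpe; have [frq frh expG] := hqh.
split; [exact: frame_tensor|exact: frame_tensor|] => u v.
have [B B0 synF] := frame_synthesis dotF frp.
have [B' B'0 synG] := frame_synthesis dotG frq.
have [D _ besF] := frame_bessel dotF fre.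
have [D' _ besG] := frame_bessel dotG frh.
exact: (tensor_expansion
  (x := fun i => jF (p i)) (y := fun i => jG (q i))
  (c := fun i => ip1 u (e i) a) (c' := fun i => ip2 v (h i) b)
  dotT B0 B'0 synF synG (besF u) (besG v)
  (sqn_cvg0 (expF u)) (sqn_cvg0 (expG v))).
Qed.
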